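(* Let $p$ be an odd prime, $q=p^{\beta}$ with $\beta=2\alpha$, $\alpha\ge1$, and let $\chi,\psi$ be primitive Dirichlet characters modulo $q$. Let $A$ be an integer with $A\equiv\ell_\chi\overline{\ell_\psi}\pmod{p^{\beta-1}}$ and $\Delta=A^2+4$. Then \[ |g(\chi,\psi)|\le q\,\rho(\Delta,p^{\alpha}). \]
   Context: $g(\chi,\psi)=\sum_{u,t\bmod q}\chi(t)\overline{\chi}(t+1)\overline{\chi}(u)\chi(u+1)\psi(ut-1)$. For a character $\chi$ modulo $p^\beta$ ($p$ odd, $\beta\ge2$), $\ell_\chi\in\mathbb{Z}/p^{\beta-1}\mathbb{Z}$ is the unique class with $\chi(1+pt)=e_{p^\beta}(\ell_\chi\log_p(1+pt))$ for all $t\in\mathbb{Z}$, where $\log_p$ is the $p$-adic logarithm and $e_{p^\beta}(x)=e^{2\pi i\{x/p^\beta\}_p}$; for primitive $\chi$, $\ell_\chi$ is a unit mod $p$, and $\overline{\ell_\psi}$ denotes its inverse modulo $p^{\beta-1}$. $\rho(\Delta,p^{\alpha})=\#\{x\bmod p^{\alpha}:x^2\equiv\Delta\bmod p^{\alpha}\}$. *)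

(* Defs.v *)
From HB Require Import structures.
From mathcomp Require Import all_boot all_order all_algebra.
From mathcomp Require Import complex.
From mathcomp Require Import all_classical all_reals all_analysis.

Set Implicit Arguments.
Unset Strict Implicit.
Unset Printing Implicit Defensive.

Import Order.TTheory GRing.Theory Num.Theory.
Local Open Scope ring_scope.

(* Dirichlet characters are q-periodic functions on the integers, so that the
   modulus q = 1 is covered as well ('Z_1 is not the zero ring). *)
Record dirichlet_char (R : realType) (q : nat) := DirichletChar {
  dchar_fun :> int -> R[i];
  dchar_periodic : forall n : int, dchar_fun (n + q%:Z) = dchar_fun n;
  dchar_mul : forall m n : int, dchar_fun (m * n) = dchar_fun m * dchar_fun n;
  dchar_neq0 : forall n : int, (dchar_fun n != 0) = coprimez n q%:Z
}.

Definition induced_from (R : realType) (q d : nat) (chi : dirichlet_char R q) :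
    Prop :=
  exists chi' : dirichlet_char R d,
    forall n : int, coprimez n q%:Z -> chi n = chi' n.

Definition primitive_char (R : realType) (q : nat) (chi : dirichlet_char R q) :
    Prop :=
  forall d : nat, (d %| q)%N -> (d < q)%N -> ~ induced_from d chi.

(* An element of Q_p is given by a p-adic Cauchy sequence of rationals.  For
   rationals, membership in Z_p means that p does not divide the denominator. *)
Definition padic_integral (p : nat) (x : rat) : bool :=
  ~~ (p %| `|denq x|)%N.

(* r = {x}_p, where x = lim u in Q_p: the unique r in Z[1/p] with 0 <= r < 1
   and x - r in Z_p.  As Z_p is open and closed in Q_p, x - r is in Z_p exactly
   when u n - r is in Z_p for all large n. *)
Definition is_padic_frac (p : nat) (u : nat -> rat) (r : rat) : Prop :=
  [/\ 0 <= r < 1,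
      exists k : nat, r * p%:R ^+ k \is a Num.int
    & exists N : nat, forall n : nat, (N <= n)%N -> padic_integral p (u n - r)].

Definition padic_frac (p : nat) (u : nat -> rat) : rat :=
  xget 0 [set r | is_padic_frac p u r]%classic.

(* Partial sums of the series defining log_p x; for x = 1 + p t this sequence
   converges in Q_p. *)
Definition padic_log (x : rat) : nat -> rat :=
  fun n => \sum_(1 <= k < n.+1) (-1) ^+ k.-1 * (x - 1) ^+ k / k%:R.

Definition cis (R : realType) (x : R) : R[i] :=
  Complex (cos x) (sin x).

(* e_{p^beta}(x) = exp(2 pi i {x / p^beta}_p), where x = lim u in Q_p. *)
Definition e_ppow (R : realType) (p beta : nat) (u : nat -> rat) : R[i] :=
  cis (2 * pi * ratr (padic_frac p (fun n => u n / p%:R ^+ beta))).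

(* The right-hand side depends only on l modulo p^(beta - 1), as
   log_p (1 + p t) lies in p Z_p. *)
Definition is_ell (R : realType) (p beta : nat)
    (chi : dirichlet_char R (p ^ beta)) (l : 'Z_(p ^ beta.-1)) : Prop :=
  forall t : int,
    chi (1 + p%:Z * t) =
    e_ppow R p beta (fun n => (l : nat)%:R * padic_log (1 + p%:Z * t)%:~R n).

Definition ell (R : realType) (p beta : nat)
    (chi : dirichlet_char R (p ^ beta)) : 'Z_(p ^ beta.-1) :=
  xget 0 [set l | is_ell chi l]%classic.

Definition gsum (R : realType) (q : nat) (chi psi : dirichlet_char R q) : R[i] :=
  \sum_(u < q) \sum_(t < q)
    chi t%:Z * (chi (t%:Z + 1))^* * (chi u%:Z)^* * chi (u%:Z + 1)
      * psi (u%:Z * t%:Z - 1).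

Definition rho (Delta : int) (m : nat) : nat :=
  #|[set x : 'I_m | (x%:Z ^+ 2 == Delta %[mod m%:Z])%Z]|.

(* Main.v *)
Require Import Defs.
From HB Require Import structures.
From mathcomp Require Import all_boot all_order all_algebra.
From mathcomp Require Import complex ring zify.
From mathcomp Require Import all_classical all_reals all_analysis.

Import Order.TTheory GRing.Theory Num.Theory.
Local Open Scope ring_scope.

(* Put P = p^alpha, so that q = P^2, and e_P(c) = exp(2 pi i c / P).  Since
   log_p(1 + P z) = P z modulo P^2, a character chi modulo q satisfies
   chi(x + P y) = chi(x) e_P(ell_chi y / x) for every unit x.  Hence the shift
   (u, t) -> (u + P w, t + P z) multiplies the summand of g by e_P(c w + d z),
   where c and d depend only on u and t, and averaging over all w and z leaves
   only the terms with c = d = 0 modulo P.  Dividing by ell_psi, which is a unit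
   because psi is primitive, these two equations become u = - t - 2 and
   s^2 + A s - 1 = 0 with s = t + 1, that is, (2 s + A)^2 = A^2 + 4; each solution
   modulo P has P^2 = q lifts modulo q.

   The class ell_chi exists because 1 + p generates the units congruent to 1
   modulo p and log_p is additive modulo p^beta.  The latter is read off from
   log_p x = (x^(p^n) - 1) / p^n modulo p^beta, valid for n = 3 beta. *)

(** * Additive characters *)

Section Cis.
Variable R : realType.

Lemma cisD (x y : R) : cis (x + y) = cis x * cis y.
Proof.
by rewrite /cis cosD sinD; congr Complex; rewrite addrC mulrC [sin x * _]mulrC.
Qed.

Lemma cis0 : cis (0 : R) = 1.
Proof. by rewrite /cis cos0 sin0. Qed.

Lemma conj_cis (x : R) : (cis x)^* = cis (- x).
Proof. by rewrite /cis cosN sinN. Qed.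

Lemma cis_2pi_int (k : int) : cis (2 * pi * k%:~R : R) = 1.
Proof.
have h : cis (2 * pi : R) = 1.
  by rewrite mulr_natl /cis cos2pi mulr2n sinD sinpi mulr0 mul0r addr0.
have hn (n : nat) : cis (2 * pi * n%:R : R) = 1.
  elim: n => [|n IHn]; first by rewrite mulr0 cis0.
  by rewrite -[n.+1]addn1 natrD mulrDr mulr1 cisD IHn h mulr1.
case: k => n; first exact: hn.
by rewrite NegzE mulrNz mulrN -conj_cis hn conjC1.
Qed.

(** By the half-angle formula [cos x] is 1 minus twice the square of [sin (x / 2)], and that sine is
    positive since x / 2 lies strictly between 0 and pi. *)
Lemma cis_neq1 (x : R) : 0 < x < 2 * pi -> cis x != 1.
Proof.
move=> /andP[x0 x2]; apply/eqP => /(congr1 (@complex.Re R)) /= c1.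
have s0 : 0 < sin (x / 2).
  by apply: sin_gt0_pi; rewrite divr_gt0 ?ltr0n//= ltr_pdivrMr ?ltr0n// mulrC.
have : cos x = 1 - sin (x / 2) ^+ 2 *+ 2.
  rewrite [in LHS](_ : x = (x / 2) *+ 2); last by rewrite -mulr_natr divfK ?pnatr_eq0.
  rewrite cos_mulr2n cos2sin2. ring.
rewrite c1 => /eqP; rewrite -subr_eq0 opprB addrCA subrr addr0 mulrn_eq0 /=.
by rewrite sqrf_eq0 gt_eqF.
Qed.

End Cis.

Definition expz (R : realType) (n : nat) (c : int) : R[i] :=
  cis (2 * pi * (c%:~R / n%:R)).

Section AdditiveCharacter.
Variables (R : realType) (n : nat).
Hypothesis n_gt0 : (0 < n)%N.
Local Notation E := (expz R n).

Lemma expzD c d : E (c + d) = E c * E d.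
Proof. by rewrite /expz intrD (mulrDl c%:~R) (mulrDr (2 * pi)) cisD. Qed.

Lemma expz0 : E 0 = 1.
Proof. by rewrite /expz mul0r mulr0 cis0. Qed.

Lemma conj_expz c : (E c)^* = E (- c).
Proof. by rewrite /expz conj_cis mulrNz mulNr mulrN. Qed.

Lemma expzM (c : int) (k : nat) : E (c * k%:Z) = E c ^+ k.
Proof.
elim: k => [|k IHk]; first by rewrite mulr0 expz0.
by rewrite -addn1 PoszD mulrDr mulr1 expzD IHk exprD expr1.
Qed.

Lemma expz_dvd c : (n%:Z %| c)%Z -> E c = 1.
Proof.
case/dvdzP => k ->; rewrite /expz intrM -pmulrn mulfK ?cis_2pi_int//.
by rewrite pnatr_eq0 -lt0n.
Qed.

Lemma expz_eq c d : (n%:Z %| c - d)%Z -> E c = E d.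
Proof. by move/expz_dvd => h; rewrite -(subrK d c) expzD h mul1r. Qed.

Lemma expz_neq1 c : ~~ (n%:Z %| c)%Z -> E c != 1.
Proof.
move=> h; have n0 : (n%:R : R) != 0 by rewrite pnatr_eq0 -lt0n.
have pn : (0 < n%:R :> R) by rewrite ltr0n.
rewrite (@expz_eq c (c %% n%:Z)%Z); last by rewrite {1}(divz_eq c n%:Z) addrK dvdz_mull.
have r0 : (0 <= (c %% n%:Z)%Z) by rewrite modz_ge0// -lt0n.
have rn : (c %% n%:Z)%Z < n%:Z by rewrite ltz_mod// -lt0n.
have : (c %% n%:Z)%Z != 0 by apply: contra h => /eqP h; apply/dvdz_mod0P.
move: r0 rn; case: (c %% n%:Z)%Z => // r _ rn r0.
apply: cis_neq1; have pi0 := @pi_gt0 R.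
have r0' : (0 < r)%N by case: r r0 {rn}.
have d0 : 0 < r%:Z%:~R / n%:R :> R by rewrite divr_gt0 ?ltr0n ?ltr0z.
rewrite (mulr_gt0 (mulr_gt0 _ pi0) d0) ?ltr0n//=.
by rewrite gtr_pMr ?mulr_gt0 ?ltr0n// ltr_pdivrMr// mul1r ltr_nat.
Qed.

Lemma sum_expz c :
  \sum_(w < n) E (c * w%:Z) = if (n%:Z %| c)%Z then n%:R else 0.
Proof.
case: ifPn => h.
  rewrite (eq_bigr (fun=> 1)) ?sumr_const ?card_ord// => w _.
  by rewrite expz_dvd// dvdz_mulr.
have h1 : E c - 1 != 0 by rewrite subr_eq0 expz_neq1.
apply: (mulfI h1); rewrite mulr0.
rewrite (eq_bigr (fun w : 'I_n => E c ^+ w)) => [|w _]; last by rewrite expzM.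
by rewrite -subrX1 -expzM expz_dvd ?subrr// dvdz_mull.
Qed.

Lemma unity_root_expz (x : R[i]) : x ^+ n = 1 -> exists c : nat, x = E c%:Z.
Proof.
move=> xn; have prim : n.-primitive_root (E 1).
  apply/andP; split=> //; apply/forallP => i; rewrite unity_rootE -expzM mul1r.
  case: (eqVneq i.+1 n) => [->|ni]; first by rewrite expz_dvd ?eqxx.
  apply/eqP/negbTE/expz_neq1; rewrite dvdzE /=; apply: contra ni => /dvdn_leq h.
  by rewrite eqn_leq ltn_ord h.
have [i ->] := prim_rootP prim xn.
by exists i; rewrite -expzM mul1r.
Qed.

End AdditiveCharacter.

(** * Units congruent to 1 modulo p *)

Lemma PoszX (m n : nat) : (m ^ n)%N%:Z = m%:Z ^+ n.
Proof. by elim: n => // n IHn; rewrite expnS exprS PoszM IHn. Qed.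

(** The explicit integer remainder lets later congruences be settled by naming a quotient and
    checking a ring identity. *)
Lemma exprD_taylor2 (y d : int) (k : nat) :
  exists r, (y + d) ^+ k.+1 = y ^+ k.+1 + k.+1%:Z * y ^+ k * d + d ^+ 2 * r.
Proof.
elim: k => [|k [r IHk]]; first by exists 0; ring.
exists (r * (y + d) + k.+1%:Z * y ^+ k); rewrite exprSr IHk.
rewrite -[k.+2]addn1 PoszD exprD !exprSr; ring.
Qed.

Lemma expr1D_taylor2 (y : int) (k : nat) :
  exists r, (1 + y) ^+ k = 1 + k%:Z * y + y ^+ 2 * r.
Proof.
case: k => [|k]; first by exists 0; rewrite expr0; ring.
by have [r ->] := exprD_taylor2 1 y k; exists r; rewrite !expr1n mulr1.
Qed.

Lemma expr1D_taylor3 (y : int) (k : nat) :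
  exists r, (1 + y) ^+ k = 1 + k%:Z * y + 'C(k, 2)%:Z * y ^+ 2 + y ^+ 3 * r.
Proof.
elim: k => [|k [r IHk]]; first by exists 0; rewrite expr0 bin0n /=; ring.
exists (r * (1 + y) + 'C(k, 2)%:Z); rewrite exprSr IHk binS bin1.
rewrite -[k.+1]addn1 !PoszD; ring.
Qed.

(** In the expansion of x ^ p around y the linear term gains the factor p, and the remainder is
    divisible by p ^ (2 j), where 2 j >= j + 1. *)
Lemma dvdz_expB_prime (p j : nat) (x y : int) : (0 < p)%N -> (0 < j)%N ->
  (p%:Z ^+ j %| x - y)%Z -> (p%:Z ^+ j.+1 %| x ^+ p - y ^+ p)%Z.
Proof.
case: p => // p _ j0 /dvdzP[s h].
have [r] := exprD_taylor2 y (x - y) p; rewrite subrKC => ->.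
rewrite h addrAC addrAC -addrA addrC addrA subrK; apply/dvdzP.
exists (y ^+ p * s + s ^+ 2 * p.+1%:Z ^+ j.-1 * r).
rewrite -[in RHS](prednK j0) -[in LHS](prednK j0) !exprS; ring.
Qed.

Lemma dvdz_expB_ppow (p j m : nat) (x y : int) : (0 < p)%N -> (0 < j)%N ->
  (p%:Z ^+ j %| x - y)%Z ->
  (p%:Z ^+ (j + m) %| x ^+ (p ^ m) - y ^+ (p ^ m))%Z.
Proof.
move=> p0 j0 h; elim: m => [|m IHm]; first by rewrite addn0 expn0 !expr1.
by rewrite addnS expnSr !exprM dvdz_expB_prime// addn_gt0 j0.
Qed.

(** On raising 1 + p ^ (i + 1) w to the power p, the cofactor w changes only by a multiple of p: the
    quadratic term has the coefficient 'C(p, 2), which p divides as p is odd, and the cubic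
    remainder is small enough by itself. *)
Lemma expr1D_ppow (p i : nat) : prime p -> odd p ->
  exists2 w, (1 + p%:Z) ^+ (p ^ i) = 1 + p%:Z ^+ i.+1 * w & coprimez w p%:Z.
Proof.
move=> pp op; have p2 : (2 < p)%N by apply: odd_prime_gt2.
have [c cE] : exists c, 'C(p, 2) = (p * c)%N.
  by case/dvdnP: (@prime_dvd_bin 2 _ pp p2) => c ->; exists c; rewrite mulnC.
elim: i => [|i [w IHi wp]].
  by exists 1; rewrite ?expn0 ?expr1 ?mulr1// /coprimez gcd1z.
rewrite expnSr exprM IHi.
have [r ->] := expr1D_taylor3 (p%:Z ^+ i.+1 * w) p.
exists (w + p%:Z * (c%:Z * p%:Z ^+ i * w ^+ 2 + p%:Z ^+ i * p%:Z ^+ i * w ^+ 3 * r)).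
  rewrite cE PoszM !exprS; ring.
rewrite coprimez_sym; apply/coprimezP.
move: wp; rewrite coprimez_sym => /coprimezP[[a b] /= ab].
set X := (_ + _ in X in p%:Z * X).
(* Bezout pair for p and w + p X, obtained from a p + b w = 1. *)
exists (a - b * X, b) => /=; rewrite -ab; ring.
Qed.

Lemma coprimez_inv (x n : int) : coprimez x n -> exists y, (n %| x * y - 1)%Z.
Proof.
case/coprimezP => [[a b] /= ab]; exists a; rewrite -ab; apply/dvdzP; exists (- b); ring.
Qed.

Lemma coprimez_solve (x n c : int) : coprimez x n -> exists y, (n %| x * y - c)%Z.
Proof.
case/coprimez_inv => y /dvdzP[s h]; exists (y * c); apply/dvdzP; exists (s * c).
by rewrite mulrAC -h; ring.
Qed.

Lemma dvdz_modn (n : nat) (x : int) : (0 < n)%N ->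
  exists2 k : nat, (k < n)%N & (n%:Z %| k%:Z - x)%Z.
Proof.
move=> n0; have r0 : (0 <= (x %% n%:Z)%Z) by rewrite modz_ge0// -lt0n.
have rn : (x %% n%:Z)%Z < n%:Z by rewrite ltz_mod// -lt0n.
have : (n%:Z %| (x %% n%:Z)%Z - x)%Z.
  by apply/dvdzP; exists (- (x %/ n%:Z)%Z); rewrite {2}(divz_eq x n%:Z); ring.
by move: r0 rn; case: (x %% n%:Z)%Z => // k _ kn d; exists k.
Qed.

(** Successive approximation of the exponent: an error s p ^ (j + 1) is removed by a factor (1 + p)
    ^ (p ^ j c), which is 1 + p ^ (j + 1) w c to first order, with c chosen so that w c = s modulo
    p. *)
Lemma one_units_cyclic (p j : nat) (t : int) : prime p -> odd p ->
  exists k : nat, (p%:Z ^+ j.+1 %| 1 + p%:Z * t - (1 + p%:Z) ^+ k)%Z.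
Proof.
move=> pp op; elim: j => [|j [k /dvdzP[s IHj]]].
  by exists 0%N; rewrite expr0 expr1 addrAC subrr add0r dvdz_mulr.
have [w wE wp] := expr1D_ppow p j pp op.
have [y /dvdzP[z hz]] := @coprimez_solve w p%:Z s wp.
have [c _ /dvdzP[v hv]] := dvdz_modn p y (prime_gt0 pp).
have [r hr] := expr1D_taylor2 (p%:Z ^+ j.+1 * w) c.
have [r' hr'] := expr1D_taylor2 p%:Z k.
exists (k + p ^ j * c)%N; rewrite exprD exprM wE hr.
apply/dvdzP.
have e1 : 1 + p%:Z * t = s * p%:Z ^+ j.+1 + (1 + p%:Z) ^+ k by rewrite -IHj subrK.
have e2 : s = w * y - z * p%:Z by rewrite -hz; ring.
have e3 : c%:Z = y + v * p%:Z by rewrite -hv; ring.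
rewrite e1 hr' e2 e3.
exists (- z - v * w - (k%:Z + p%:Z * r') * (y + v * p%:Z) * w
   - (1 + k%:Z * p%:Z + p%:Z^+2 * r') * p%:Z ^+ j * w ^+ 2 * r).
rewrite !exprS; ring.
Qed.

(** * The p-adic logarithm *)

Section PadicIntegral.
Variable p : nat.
Hypothesis p_prime : prime p.

(** Any denominator prime to p is allowed here, not only the reduced one, so sums and products need
    no cancellation. *)
Lemma padic_integralP (x : rat) :
  reflect (exists2 d : nat, ~~ (p %| d)%N & x * d%:R \is a Num.int)
          (padic_integral p x).
Proof.
apply: (iffP idP) => [h|[d pd /intrP[k xd]]].
  exists `|denq x|%N => //; rewrite pmulrn abszE gtr0_norm ?denq_gt0//.
  by rewrite mulrC -{2}(divq_num_den x) mulrCA mulfV ?intr_eq0 ?denq_eq0// mulr1 intr_int.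
have e : numq x * d%:Z = k * denq x.
  apply/eqP; rewrite -(eqr_int rat) !intrM -xd numqE -pmulrn; apply/eqP; ring.
have : (denq x %| d%:Z)%Z.
  rewrite -(@Gauss_dvdzr _ (numq x)) ?e ?dvdz_mull//.
  by rewrite coprimez_sym /coprimez /gcdz; have := coprime_num_den x.
rewrite dvdzE /= => h; rewrite /padic_integral; apply: contra pd => h2.
exact: dvdn_trans h2 h.
Qed.

Lemma padic_integralD x y :
  padic_integral p x -> padic_integral p y -> padic_integral p (x + y).
Proof.
move=> /padic_integralP[d pd dx] /padic_integralP[e pe ey].
apply/padic_integralP; exists (d * e)%N; first by rewrite Euclid_dvdM// negb_or pd.
have -> : (x + y) * (d * e)%:R = x * d%:R * e%:R + y * e%:R * d%:R.
  by rewrite natrM; ring.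
by rewrite rpredD// rpredM ?rpred_nat.
Qed.

Lemma padic_integralM x y :
  padic_integral p x -> padic_integral p y -> padic_integral p (x * y).
Proof.
move=> /padic_integralP[d pd dx] /padic_integralP[e pe ey].
apply/padic_integralP; exists (d * e)%N; first by rewrite Euclid_dvdM// negb_or pd.
by rewrite natrM mulrACA rpredM.
Qed.

Lemma padic_integral_int (k : int) : padic_integral p k%:~R.
Proof.
apply/padic_integralP; exists 1%N; last by rewrite mulr1 intr_int.
by rewrite dvdn1; case: p p_prime => // -[].
Qed.

Lemma padic_integralN x : padic_integral p x -> padic_integral p (- x).
Proof. by rewrite -mulN1r; apply/padic_integralM/(padic_integral_int (-1)). Qed.

(** Divisibility by p ^ b in the rationals that are integral at p; it carries congruences between
    partial sums of the logarithm and integers. *)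
Definition pdvd (b : nat) (x : rat) := padic_integral p (x / p%:R ^+ b).

Lemma pdvdD b x y : pdvd b x -> pdvd b y -> pdvd b (x + y).
Proof. by rewrite /pdvd mulrDl; exact: padic_integralD. Qed.

Lemma pdvdN b x : pdvd b x -> pdvd b (- x).
Proof. by rewrite /pdvd mulNr; exact: padic_integralN. Qed.

Lemma pdvdB b x y : pdvd b x -> pdvd b y -> pdvd b (x - y).
Proof. by move=> hx /pdvdN; exact: pdvdD. Qed.

Lemma pdvdMl b x y : padic_integral p x -> pdvd b y -> pdvd b (x * y).
Proof. by rewrite /pdvd -mulrA; exact: padic_integralM. Qed.

Lemma pdvd_sum b (I : eqType) (r : seq I) (F : I -> rat) :
  (forall i, i \in r -> pdvd b (F i)) -> pdvd b (\sum_(i <- r) F i).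
Proof.
move=> h; rewrite big_seq; apply: (big_ind (fun x => pdvd b x)) => //.
  by rewrite /pdvd mul0r; exact: (padic_integral_int 0).
exact: pdvdD.
Qed.

Lemma natp_neq0 : (p%:R : rat) != 0.
Proof. by rewrite pnatr_eq0 -lt0n prime_gt0. Qed.

Lemma pdvd_int b (k : int) : pdvd b k%:~R = (p%:Z ^+ b %| k)%Z.
Proof.
apply/idP/idP => [/padic_integralP[d pd /intrP[m]]|/dvdzP[m ->]]; last first.
  rewrite /pdvd intrM rmorphXn /= -pmulrn mulfK ?expf_neq0 ?natp_neq0//.
  exact: padic_integral_int.
move=> e; have : k * d%:Z = m * p%:Z ^+ b.
  apply/eqP; rewrite -(eqr_int rat) !intrM rmorphXn /= -e -!pmulrn.
  by rewrite [eqbRHS]mulrAC divfK ?expf_neq0 ?natp_neq0.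
move=> e2; rewrite -(@Gauss_dvdzl _ _ d%:Z) ?e2 ?dvdz_mull//.
by rewrite -PoszX coprimezE /= coprimeXl// prime_coprime.
Qed.

Lemma pdvd_le a b x : (a <= b)%N -> pdvd b x -> pdvd a x.
Proof.
move=> ab h; rewrite /pdvd.
have -> : x / p%:R ^+ a = (p%:Z ^+ (b - a))%:~R * (x / p%:R ^+ b).
  rewrite rmorphXn /= -pmulrn -[in RHS](subnK ab) exprD addnK invfM mulrCA.
  by rewrite mulVKf ?expf_neq0 ?natp_neq0.
exact/padic_integralM/h/padic_integral_int.
Qed.

Lemma pdvd_expdiv e m k : (0 < k)%N -> (e + logn p k <= m)%N ->
  pdvd e (p%:R ^+ m / k%:R).
Proof.
move=> k0 h; have [d pd kE] := pfactor_coprime p_prime k0.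
have d0 : (d%:R : rat) != 0.
  by rewrite pnatr_eq0; apply: contraTneq k0 => d0; rewrite kE d0.
apply/padic_integralP; exists d; first by rewrite -prime_coprime.
rewrite [in k%:R]kE natrM natrX -(subnK h) !exprD.
set P := p%:R ^+ e; set Q := p%:R ^+ logn p k.
rewrite [X in X \is a _](_ : _ = p%:R ^+ (m - (e + logn p k))) ?rpredX ?rpred_nat//.
by field; rewrite d0 !expf_neq0 ?natp_neq0.
Qed.

(** With v the valuation of k, 2 v <= p ^ v by induction, and p ^ v divides k. *)
Lemma logn_le_half k : odd p -> (0 < k)%N -> (2 * logn p k <= k)%N.
Proof.
move=> op k0; apply: (@leq_trans (p ^ logn p k)); last first.
  by apply: dvdn_leq => //; exact: pfactor_dvdnn.
have p2 := odd_prime_gt2 op p_prime.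
elim: (logn p k) => [|v IHv] //; rewrite expnS.
have := leq_mul p2 IHv; have : (0 < p ^ v)%N by rewrite expn_gt0 prime_gt0.
case: v IHv => [|v] IHv; last by nia.
by rewrite expn0; nia.
Qed.

Lemma logn_le_sub2 k : odd p -> (2 <= k)%N -> (logn p k <= k - 2)%N.
Proof.
move=> op k2; have k0 : (0 < k)%N by lia.
have := logn_le_half k op k0.
case: (leqP 3 k) => k3; first lia.
have -> : k = 2%N by lia.
by rewrite logn_prime// gtn_eqF ?odd_prime_gt2.
Qed.

(** * Partial sums of the logarithm, near 1 and compared with powers *)

Lemma intr1D_sub1 (y : int) : (1 + y)%:~R - 1 = y%:~R :> rat.
Proof. by rewrite intrD addrAC subrr add0r. Qed.

(** The term of degree k >= 2 has valuation at least a k - (k - 2) >= 2 a, so only the linear term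
    survives modulo p ^ (2 a). *)
Lemma padic_log_small (a n : nat) (z : int) : odd p -> (0 < a)%N -> (0 < n)%N ->
  pdvd (2 * a) (padic_log (1 + p%:Z ^+ a * z)%:~R n - (p%:Z ^+ a * z)%:~R).
Proof.
move=> op a0 n0; rewrite /padic_log intr1D_sub1 big_ltn// expr0 mul1r expr1 divr1.
rewrite addrAC subrr add0r.
apply: pdvd_sum => k; rewrite mem_index_iota => /andP[k2 _].
have -> : (-1) ^+ k.-1 * (p%:Z ^+ a * z)%:~R ^+ k / k%:R =
    ((-1) ^+ k.-1 * z ^+ k)%:~R * (p%:R ^+ (a * k) / k%:R) :> rat.
  rewrite !intrM exprMn !rmorphXn /= rmorphN -!pmulrn exprM; ring.
apply: pdvdMl; first exact: padic_integral_int.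
apply: pdvd_expdiv; first lia.
by have := logn_le_sub2 k op k2; nia.
Qed.

(** Since k 'C(p ^ m, k) is a multiple of p ^ m, at most the valuation of k is lost, and this is
    less than k. *)
Lemma binomial_ppow_dvd (m k : nat) : (0 < k)%N -> (p ^ (m - k) %| 'C(p ^ m, k))%N.
Proof.
move=> k0; case: (posnP 'C(p ^ m, k)) => [->|C0]; first exact: dvdn0.
rewrite pfactor_dvdn//; have h : (p ^ m %| k * 'C(p ^ m, k))%N.
  by case: k k0 C0 => // k _ _; rewrite -mul_bin_diag dvdn_mulr.
have := h; rewrite pfactor_dvdn ?muln_gt0 ?k0// lognM// => h2.
have : (logn p k < k)%N by rewrite ltn_logl.
lia.
Qed.

(** By Pascal's rule two neighbouring coefficients add up to 'C(p ^ m, k + 1), which vanishes modulo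
    p ^ b; hence the signs alternate as in the logarithm series. *)
Lemma binomial_ppow_pred (b m k : nat) : (b + k <= m)%N ->
  (p%:Z ^+ b %| 'C((p ^ m).-1, k)%:Z - (-1) ^+ k)%Z.
Proof.
elim: k => [|k IHk] h; first by rewrite bin0 subrr dvdz0.
have /dvdzP[r hr] : (p%:Z ^+ b %| 'C((p ^ m).-1, k)%:Z - (-1) ^+ k)%Z by apply: IHk; lia.
have /dvdnP[s hs] : (p ^ b %| 'C(p ^ m, k.+1))%N.
  by apply: dvdn_trans (binomial_ppow_dvd m _ _) => //; apply: dvdn_exp2l; lia.
move: hs; rewrite -{1}(@prednK (p ^ m)) ?expn_gt0 ?prime_gt0// binS => hs.
have : 'C((p ^ m).-1, k.+1)%:Z + 'C((p ^ m).-1, k)%:Z = s%:Z * p%:Z ^+ b.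
  by rewrite -PoszD hs PoszM PoszX.
move=> e; apply/dvdzP; exists (s%:Z - r); rewrite mulrBl -e -hr exprS; ring.
Qed.

(** The identity 'C(M, k) / M = 'C(M - 1, k - 1) / k gives the shape of the logarithm series; beyond
    M the binomials vanish, so the sum may run up to n. *)
Lemma expr1D_divE (M n : nat) (X : rat) : (0 < M)%N -> (M <= n)%N ->
  ((1 + X) ^+ M - 1) / M%:R = \sum_(1 <= k < n.+1) 'C(M.-1, k.-1)%:R * (X ^+ k / k%:R).
Proof.
move=> M0 Mn; rewrite exprDn.
rewrite (eq_bigr (fun i : 'I_M.+1 => 'C(M, i)%:R * X ^+ i)); last first.
  by move=> i _; rewrite expr1n mul1r mulr_natl.
rewrite -(big_mkord xpredT (fun i => 'C(M, i)%:R * X ^+ i)) big_ltn// bin0 mul1r.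
rewrite expr0 addrAC subrr add0r mulr_suml.
rewrite (@big_cat_nat _ _ _ M.+1 1 n.+1) //= [Y in _ = _ + Y](_ : _ = 0) ?addr0.
  apply: eq_big_nat => -[|k] //= _.
  have /(congr1 (fun x => x%:R : rat)) := mul_bin_diag M k; rewrite !natrM => e.
  apply: (@mulfI _ (M%:R * k.+1%:R)); first by rewrite mulf_neq0 ?pnatr_eq0 -?lt0n.
  have M1 : (M%:R : rat) != 0 by rewrite pnatr_eq0 -lt0n.
  have k1 : (k.+1%:R : rat) != 0 by rewrite pnatr_eq0.
  transitivity (k.+1%:R * 'C(M, k.+1)%:R * X ^+ k.+1); first by field.
  by rewrite -e; field.
by rewrite big_nat big1// => k /andP[h _]; rewrite bin_small ?mul0r//; lia.
Qed.

(** Compare term by term. For k >= 2 b, p ^ k / k is already divisible by p ^ b; for k < 2 b the two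
    coefficients agree modulo p ^ b because b + (k - 1) <= 3 b. *)
Lemma padic_log_limit (b n : nat) (t : int) :
  odd p -> (0 < b)%N -> (p ^ (3 * b) <= n)%N ->
  pdvd b (padic_log (1 + p%:Z * t)%:~R n
          - ((1 + p%:Z * t)%:~R ^+ (p ^ (3 * b)) - 1) / (p ^ (3 * b))%:R).
Proof.
move=> op b0 Mn; rewrite [X in X ^+ (p ^ _)]intrD (@expr1D_divE _ n)//; last first.
  by rewrite expn_gt0 prime_gt0.
rewrite /padic_log -sumrB; apply: pdvd_sum => k; rewrite mem_index_iota => /andP[k1 _].
rewrite intr1D_sub1 -mulrA -mulrBl.
have -> : (-1) ^+ k.-1 - 'C((p ^ (3 * b)).-1, k.-1)%:R =
   ((-1) ^+ k.-1 - 'C((p ^ (3 * b)).-1, k.-1)%:Z)%:~R :> rat.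
  by rewrite intrB rmorphXn /= -pmulrn rmorphN.
have Tk : (p%:Z * t)%:~R ^+ k / k%:R = (t ^+ k)%:~R * (p%:R ^+ k / k%:R) :> rat.
  rewrite intrM exprMn rmorphXn /= -pmulrn; ring.
case: (leqP (2 * b) k) => hk.
  rewrite Tk; do 2! (apply: pdvdMl; first exact: padic_integral_int).
  by apply: pdvd_expdiv => //; have := logn_le_half k op k1; lia.
rewrite mulrC; apply: pdvdMl; last first.
  by rewrite pdvd_int -rpredN opprB binomial_ppow_pred//; lia.
rewrite Tk; apply: padic_integralM; first exact: padic_integral_int.
have : pdvd 0 (p%:R ^+ k / k%:R); last by rewrite /pdvd expr0 divr1.
by apply: pdvd_expdiv => //; have := logn_le_half k op k1; lia.
Qed.

Lemma e_ppowE (R : realType) (b : nat) (u : nat -> rat) (c : int) :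
  (exists N : nat, forall n : nat, (N <= n)%N -> pdvd b (u n - c%:~R)) ->
  e_ppow R p b u = expz R (p ^ b) c.
Proof.
case=> N hN; set v := fun n => u n / p%:R ^+ b.
have pb0 : (p%:R ^+ b : rat) != 0 by rewrite expf_neq0 ?natp_neq0.
have pb0' : (0 < p ^ b)%N by rewrite expn_gt0 prime_gt0.
have fracP : is_padic_frac p v (padic_frac p v).
  (* The residue k of c modulo p ^ b gives the fractional part k / p ^ b, so [xget] does not fall
     back on its default 0. *)
  have [k kn /dvdzP[s hs]] := dvdz_modn (p ^ b) c pb0'.
  apply: (@xgetI _ 0 [set r | is_padic_frac p v r]%classic (k%:R / p%:R ^+ b)).
  split.
  - have pb1 : (0 < p%:R ^+ b :> rat) by rewrite -natrX ltr0n.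
    rewrite divr_ge0 ?ler0n ?(ltW pb1)//= ltr_pdivrMr// mul1r -natrX ltr_nat//.
  - by exists b; rewrite divfK// rpred_nat.
  - exists N => n /hN; rewrite /pdvd /v => h.
    rewrite [X in padic_integral p X](_ : _ = (u n - c%:~R) / p%:R ^+ b + (- s)%:~R).
      exact/padic_integralD/padic_integral_int.
    have -> : c = k%:Z - s * (p ^ b)%N%:Z by rewrite -hs; ring.
    by rewrite intrB intrM -!pmulrn natrX rmorphN /=; field.
rewrite /e_ppow -/v; move: fracP; set r := padic_frac p v => -[_ [k rk] [N' hN']].
(* The difference is integral at p and has a power of p as denominator, hence is an integer. *)
have [m hm] : exists m : int, r - c%:~R / p%:R ^+ b = m%:~R.
  have pi : padic_integral p (r - c%:~R / p%:R ^+ b).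
    rewrite [X in padic_integral p X](_ : _ = (u (maxn N N') - c%:~R) / p%:R ^+ b
       - (v (maxn N N') - r)); last by rewrite /v; field.
    apply: padic_integralD; first by apply: hN; rewrite leq_maxl.
    by apply: padic_integralN; apply: hN'; rewrite leq_maxr.
  have /intrP[j hj] : (r - c%:~R / p%:R ^+ b) * p%:R ^+ (k + b) \is a Num.int.
    rewrite exprD; set P := p%:R ^+ k; rewrite -/P in rk.
    have -> : (r - c%:~R / p%:R ^+ b) * (P * p%:R ^+ b) = r * P * p%:R ^+ b - c%:~R * P.
      by field.
    by apply: rpredB; apply: rpredM; rewrite ?intr_int ?rpredX ?rpred_nat.
  have pkb : (p%:R ^+ (k + b) : rat) != 0 by rewrite expf_neq0 ?natp_neq0.
  have : pdvd (k + b) j%:~R by rewrite /pdvd -hj mulfK.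
  rewrite pdvd_int => /dvdzP[m mj]; exists m; apply: (mulIf pkb).
  by rewrite hj mj intrM rmorphXn /= -pmulrn.
have -> : r = c%:~R / p%:R ^+ b + m%:~R by rewrite -hm subrKC.
rewrite rmorphD /= ratr_int (mulrDr (2 * pi)) cisD cis_2pi_int mulr1 /expz.
by rewrite fmorph_div rmorphXn /= ratr_int ratr_nat natrX.
Qed.

End PadicIntegral.

(** * Dirichlet characters *)

Section DirichletCharacter.
Variables (R : realType) (q : nat) (chi : dirichlet_char R q).

Lemma dchar_eq (x y : int) : (q%:Z %| x - y)%Z -> chi x = chi y.
Proof.
case/dvdzP => k e; have {e} -> : x = y + k * q%:Z by rewrite -e addrC subrK.
have hn (z : int) (n : nat) : chi (z + n%:Z * q%:Z) = chi z.
  elim: n => [|n IHn]; first by rewrite mul0r addr0.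
  by rewrite -addn1 PoszD mulrDl mul1r addrA dchar_periodic.
case: k => n; first exact: hn.
by rewrite NegzE mulNr -[LHS](hn _ n.+1) subrK.
Qed.

Lemma dchar_coprime (x : int) : chi x != 0 -> coprimez x q%:Z.
Proof. by rewrite dchar_neq0. Qed.

Lemma dchar_noncoprime (x : int) : ~~ coprimez x q%:Z -> chi x = 0.
Proof. by rewrite -(dchar_neq0 chi) negbK => /eqP. Qed.

Lemma dchar1 : chi 1 = 1.
Proof.
have h : chi 1 != 0 by rewrite dchar_neq0 /coprimez gcd1z.
by apply: (mulfI h); rewrite -dchar_mul !mulr1.
Qed.

Lemma dcharX (x : int) (n : nat) : chi (x ^+ n) = chi x ^+ n.
Proof.
elim: n => [|n IHn]; first by rewrite !expr0 dchar1.
by rewrite !exprS dchar_mul IHn.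
Qed.

Lemma norm_dchar_le1 (x : int) : (0 < q)%N -> `|chi x| <= 1.
Proof.
move=> q0; have [|/dchar_noncoprime->] := boolP (coprimez x q%:Z); last first.
  by rewrite normr0 ler01.
have [k kq kx] := dvdz_modn q x q0; move=> cx.
have ck : coprime k q.
  have h : chi k%:Z != 0 by rewrite (dchar_eq _ _ kx) dchar_neq0.
  by move: (dchar_coprime _ h); rewrite coprimezE.
rewrite -(dchar_eq _ _ kx).
have t0 : (0 < totient q)%N by rewrite totient_gt0.
(* Euler's theorem makes the value a root of unity. *)
have h : chi k%:Z ^+ totient q = 1.
  rewrite -dcharX -PoszX -dchar1; apply: dchar_eq; rewrite -eqz_mod_dvd.
  by rewrite !modz_nat cyclic.Euler_exp_totient.
have /eqP : `|chi k%:Z| ^+ totient q = 1 by rewrite -normrX h normr1.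
by rewrite pexpr_eq1// => /eqP ->.
Qed.

End DirichletCharacter.

Lemma expz_scale (R : realType) (n m : nat) (c : int) : (0 < m)%N ->
  expz R (n * m) (c * m%:Z) = expz R n c.
Proof.
move=> m0; rewrite /expz intrM natrM -pmulrn -mulf_div divff ?mulr1//.
by rewrite pnatr_eq0 -lt0n.
Qed.

(** * Existence of the class ell_chi, and its being a unit *)

Section Ell.
Variables (R : realType) (p b : nat).
Hypotheses (p_prime : prime p) (p_odd : odd p) (b_ge2 : (2 <= b)%N).
Variable chi : dirichlet_char R (p ^ b).

Let b_gt0 : (0 < b)%N. Proof. exact: ltnW. Qed.
Let p_gt0 : (0 < p)%N. Proof. exact: prime_gt0. Qed.

(** Represents the logarithm modulo p ^ b by an integer p f read off from a power of 1 + p t, so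
    that additivity can be deduced from congruences between powers. *)
Lemma padic_log_int (t : int) : exists2 f : int,
  (1 + p%:Z * t) ^+ (p ^ (3 * b)) = 1 + p%:Z * p%:Z ^+ (3 * b) * f &
  forall n, (p ^ (3 * b) <= n)%N ->
    pdvd p b (padic_log (1 + p%:Z * t)%:~R n - (p%:Z * f)%:~R).
Proof.
have /dvdzP[f] : (p%:Z ^+ (1 + 3 * b) %|
    (1 + p%:Z * t) ^+ (p ^ (3 * b)) - 1 ^+ (p ^ (3 * b)))%Z.
  by apply: dvdz_expB_ppow => //; rewrite expr1 addrAC subrr add0r dvdz_mulr.
rewrite expr1n add1n exprS => e.
exists f; first by rewrite [_ * f]mulrC -e subrKC.
move=> n /(@padic_log_limit p p_prime b n t p_odd b_gt0).
have M0 : ((p ^ (3 * b))%:R : rat) != 0 by rewrite pnatr_eq0 -lt0n expn_gt0 p_gt0.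
have /(congr1 (fun z : int => z%:~R : rat)) := e; rewrite intrB rmorphXn /= => ->.
rewrite !intrM rmorphXn /= -pmulrn -natrX mulrA mulfK//.
by rewrite [f%:~R * _]mulrC.
Qed.

Lemma e_ppow_log (l : nat) (u : nat -> rat) (c : int) :
  (exists N, forall n, (N <= n)%N -> pdvd p b (u n - c%:~R)) ->
  e_ppow R p b (fun n => l%:R * u n) = expz R (p ^ b) (l%:Z * c).
Proof.
case=> N hN; apply: e_ppowE => //; exists N => n /hN h.
by rewrite intrM -mulrBr; apply: pdvdMl => //; exact: (@padic_integral_int p p_prime l).
Qed.

(** With log (1 + p) = p f1 and chi (1 + p) = e(c / p ^ (b - 1)), solve l f1 = c modulo p ^ (b - 1).
    For 1 + p t = (1 + p) ^ k modulo p ^ b, both sides are then e(k c / p ^ (b - 1)). *)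
Lemma is_ell_exists : exists l, is_ell chi l.
Proof.
have [f1 f1E f1log] := padic_log_int 1; rewrite mulr1 in f1E f1log.
have q1 : (1 < p ^ b.-1)%N.
  by rewrite -{1}(expn0 p) ltn_exp2l ?prime_gt1//; lia.
have qE : (p ^ b = p ^ b.-1 * p)%N by rewrite -expnSr prednK.
(* Two approximations of log (1 + p) give p f1 = p modulo p ^ 2, so f1 = 1 modulo p. *)
have cf1 : coprimez f1 (p ^ b.-1)%N%:Z.
  have h2 := @padic_log_small p p_prime 1 (p ^ (3 * b)) 1 p_odd isT.
  have M0 : (0 < p ^ (3 * b))%N by rewrite expn_gt0 p_gt0.
  have h1 := pdvd_le _ p_prime _ _ _ b_ge2 (f1log _ (leqnn _)).
  have := pdvdB _ p_prime _ _ _ h1 (h2 M0).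
  rewrite expr1 mulr1 [X in pdvd _ _ X](_ : _ = (p%:Z - p%:Z * f1)%:~R);
    last by rewrite intrB; ring.
  rewrite pdvd_int//.
  move=> /dvdzP[s hs]; rewrite PoszX; apply: coprimezXr.
  have {hs} e : f1 = 1 - s * p%:Z.
    have p0 : p%:Z != 0 by rewrite eqz_nat -lt0n.
    apply: (mulfI p0); rewrite mulrBr mulrCA -expr2 -hs; ring.
  by apply/coprimezP; exists (1, s); rewrite /= e; ring.
have xE : chi (1 + p%:Z) ^+ (p ^ b.-1) = 1.
  rewrite -dcharX -(dchar1 _ _ chi); apply: dchar_eq.
  have [w -> _] := expr1D_ppow p b.-1 p_prime p_odd.
  by rewrite prednK// addrAC subrr add0r PoszX dvdz_mulr.
have [c cE] := unity_root_expz _ _ (ltnW q1) _ xE.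
have [y /dvdzP[s hs]] := coprimez_solve _ _ c%:Z cf1.
have [l lq /dvdzP[r hr]] := dvdz_modn _ y (ltnW q1).
exists l%:R => t; rewrite val_Zp_nat// modn_small//.
have [f fE flog] := padic_log_int t.
rewrite (e_ppow_log l _ (p%:Z * f)); last by exists (p ^ (3 * b))%N.
have [k hk] := one_units_cyclic p b.-1 t p_prime p_odd; rewrite prednK// in hk.
rewrite (dchar_eq _ _ chi _ ((1 + p%:Z) ^+ k)) ?PoszX// dcharX cE -expzM.
rewrite -(expz_scale R _ p)// -qE; apply: expz_eq; first by rewrite expn_gt0 p_gt0.
(* Additivity: log (1 + p t) = k log (1 + p) modulo p ^ b. The p ^ (3 b)-th powers agree modulo p ^
   (4 b); dividing by M = p ^ (3 b) leaves p ^ b, and the quadratic remainder still has a factor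
   M. *)
have /dvdzP[s' hs'] : (p%:Z ^+ b %| p%:Z * f - k%:Z * p%:Z * f1)%Z.
  have /dvdzP[v] := dvdz_expB_ppow p b (3 * b) _ _ p_gt0 b_gt0 hk.
  rewrite -exprM (mulnC k) exprM fE f1E.
  set M := p%:Z ^+ (3 * b); have [v' ->] := expr1D_taylor2 (p%:Z * M * f1) k.
  have M0 : M != 0 by rewrite expf_neq0// eqz_nat -lt0n.
  rewrite exprD -/M => e; apply/dvdzP.
  have ME : M = p%:Z ^+ b * p%:Z ^+ (2 * b) by rewrite -exprD; congr (_ ^+ _); lia.
  exists (v + (p%:Z * f1) ^+ 2 * p%:Z ^+ (2 * b) * v').
  apply: (mulfI M0).
  transitivity (v * (p%:Z ^+ b * M) + M ^+ 2 * (p%:Z * f1) ^+ 2 * v').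
    rewrite -e; ring.
  by rewrite expr2 {2}ME; ring.
rewrite PoszX; have cc : c%:Z = f1 * y - s * (p ^ b.-1)%N%:Z by rewrite -hs; ring.
have ll : l%:Z = y + r * (p ^ b.-1)%N%:Z by rewrite -hr; ring.
have ff : p%:Z * f = k%:Z * p%:Z * f1 + s' * p%:Z ^+ b by rewrite -hs'; ring.
have qb : p%:Z ^+ b = p%:Z * (p ^ b.-1)%N%:Z by rewrite PoszX -exprS prednK.
rewrite ff ll cc; apply/dvdzP.
exists (- s * k%:Z - r * k%:Z * f1 - s' * (y + r * (p ^ b.-1)%N%:Z)).
by rewrite qb; ring.
Qed.

Lemma ellP : is_ell chi (ell chi).
Proof. by have [l hl] := is_ell_exists; exact: (xgetI 0 hl). Qed.

(** As b <= 2 a, the logarithm is linear here. The case a = b - 1 serves primitivity, and the case b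
    = 2 a the stationary phase. *)
Lemma dchar_1Dppow (a : nat) (z : int) :
  (0 < a)%N -> (a <= b)%N -> (b <= 2 * a)%N ->
  chi (1 + p%:Z ^+ a * z) = expz R (p ^ (b - a)) ((ell chi : nat)%:Z * z).
Proof.
move=> a0 ab b2a; have := ellP (p%:Z ^+ a.-1 * z).
rewrite mulrA -exprS prednK// => ->.
rewrite (e_ppow_log _ _ (p%:Z ^+ a * z)); last first.
  exists 1%N => n n0; apply: pdvd_le b2a _ => //.
  exact: padic_log_small.
rewrite -[RHS](expz_scale R _ (p ^ a)) ?expn_gt0 ?p_gt0// -expnD subnK//.
by congr expz; rewrite PoszX; ring.
Qed.

(** If p divided ell_chi, chi would be trivial on 1 + p ^ (b - 1) Z, hence periodic modulo p ^ (b -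
    1), and so induced from that modulus by itself. *)
Lemma coprime_ell : primitive_char chi -> coprime p (ell chi).
Proof.
move=> prim; rewrite prime_coprime//; apply/negP => /dvdnP[m lE].
have triv (z : int) : chi (1 + p%:Z ^+ b.-1 * z) = 1.
  rewrite dchar_1Dppow; [|lia|lia|lia].
  rewrite (_ : (b - b.-1)%N = 1%N); last lia.
  by rewrite expn1 lE expz_dvd// PoszM mulrAC dvdz_mull.
apply: (prim (p ^ b.-1)%N); first by rewrite dvdn_exp2l ?leq_pred.
  by rewrite ltn_exp2l ?prime_gt1//; lia.
have cop (n : int) : coprimez n (p ^ b)%N%:Z = coprimez n (p ^ b.-1)%N%:Z.
  by rewrite !coprimezE /= !coprime_pexpr//; lia.
have per (n : int) : chi (n + (p ^ b.-1)%N%:Z) = chi n.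
  have [cn|cn] := boolP (coprimez n (p ^ b)%N%:Z); last first.
    rewrite !dchar_noncoprime//; apply: contra cn; rewrite !cop => /coprimezP[[u v] /= e].
    by apply/coprimezP; exists (u, u + v) => /=; rewrite -e; ring.
  have [y /dvdzP[s hs]] := coprimez_inv _ _ cn.
  (* With n y = 1 modulo p ^ b, the shift n + p ^ (b - 1) equals n (1 + p ^ (b - 1) y). *)
  rewrite -[RHS]mulr1 -(triv y) -dchar_mul; apply: dchar_eq; rewrite -PoszX.
  apply/dvdzP; exists (- s * (p ^ b.-1)%N%:Z).
  have e : n * y = 1 + s * (p ^ b)%N%:Z by rewrite -hs; ring.
  rewrite mulrDr mulr1 mulrCA e; ring.
have neq0 (n : int) : (chi n != 0) = coprimez n (p ^ b.-1)%N%:Z.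
  by rewrite dchar_neq0 cop.
by exists (DirichletChar per (dchar_mul chi) neq0).
Qed.

End Ell.

(** * The stationary phase argument *)

Lemma Zp_int_eq0 (n : nat) (x : int) : (1 < n)%N ->
  (x%:~R == 0 :> 'Z_n) = (n%:Z %| x)%Z.
Proof.
move=> n1; have hn (k : nat) : (k%:R == 0 :> 'Z_n) = (n %| k)%N.
  by rewrite -val_eqE /= val_Zp_nat.
case: x => k; rewrite dvdzE /=; first exact: hn.
by rewrite NegzE mulrNz oppr_eq0 hn.
Qed.

Lemma Zp_int_eq (n : nat) (x y : int) : (1 < n)%N ->
  (n%:Z %| x - y)%Z -> x%:~R = y%:~R :> 'Z_n.
Proof.
by move=> n1; rewrite -Zp_int_eq0// intrB subr_eq0 => /eqP.
Qed.

Lemma stationary_point (K : comNzRingType) (a b b' A t t' s' u u' r' v : K) :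
  a = A * b -> b * b' = 1 -> t * t' = 1 -> (t + 1) * s' = 1 ->
  u * u' = 1 -> (u + 1) * r' = 1 -> (u * t - 1) * v = 1 ->
  a * (t' - s') + b * v * u = 0 -> a * (r' - u') + b * v * t = 0 ->
  u = - t - 2 /\ (2 * (t + 1) + A) ^+ 2 = A ^+ 2 + 4.
Proof.
move=> aE bb tt ss uu rr vv ez ew.
have e1 : A * (u * t - 1) + u * t * (t + 1) = 0.
  transitivity (b' * t * (t + 1) * (u * t - 1) * (a * (t' - s') + b * v * u)); last first.
    by rewrite ez mulr0.
  transitivity (A * (b * b') * ((t * t') * (t + 1) - ((t + 1) * s') * t) * (u * t - 1)
     + u * t * (t + 1) * (b * b') * ((u * t - 1) * v)).
    by rewrite bb tt ss vv; ring.
  by rewrite aE; ring.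
have e2 : - A * (u * t - 1) + u * t * (u + 1) = 0.
  transitivity (b' * u * (u + 1) * (u * t - 1) * (a * (r' - u') + b * v * t)); last first.
    by rewrite ew mulr0.
  transitivity (A * (b * b') * (((u + 1) * r') * u - (u * u') * (u + 1)) * (u * t - 1)
     + u * t * (u + 1) * (b * b') * ((u * t - 1) * v)).
    by rewrite bb uu rr vv; ring.
  by rewrite aE; ring.
have e3 : u + t + 2 = 0.
  transitivity (u' * t' * ((A * (u * t - 1) + u * t * (t + 1))
      + (- A * (u * t - 1) + u * t * (u + 1)))); last by rewrite e1 e2 addr0 mulr0.
  transitivity ((u * u') * (t * t') * (u + t + 2)); first by rewrite uu tt; ring.
  ring.
have uE : u = - t - 2 by rewrite -[u](addrK (t + 2)) addrA e3; ring.
split=> //.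
have e4 : A * (t + 1) + t * (t + 2) = 0.
  transitivity (- s' * (A * (u * t - 1) + u * t * (t + 1))); last by rewrite e1 mulr0.
  transitivity (((t + 1) * s') * (A * (t + 1) + t * (t + 2))); first by rewrite ss mul1r.
  by rewrite uE; ring.
transitivity (4 * (A * (t + 1) + t * (t + 2)) + A ^+ 2 + 4); first ring.
by rewrite e4; ring.
Qed.

Lemma sum_periodic_shift (V : zmodType) (q : nat) (G : int -> V) (k : nat) :
  (forall x, G (x + q%:Z) = G x) ->
  \sum_(i < q) G (i%:Z + k%:Z) = \sum_(i < q) G i%:Z.
Proof.
move=> per; elim: k => [|k <-]; first by apply: eq_bigr => i _; rewrite addr0.
case: q per => [|q] per; first by rewrite !big_ord0.
rewrite big_ord_recr [RHS]big_ord_recl [LHS]addrC; congr (_ + _).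
  by rewrite /= add0r -[RHS]per; congr (G _); lia.
by apply: eq_bigr => i _; congr (G _); rewrite /= /bump /=; lia.
Qed.

(** A Bezout coefficient, total in x, so that the phases below are defined for all integers. *)
Definition zinv (q x : int) : int := (egcdz x q).1.

Lemma zinvP (q x : int) : coprimez x q -> (q %| x * zinv q x - 1)%Z.
Proof.
rewrite /zinv /coprimez; case: egcdzP => u v e _ /eqP g.
by apply/dvdzP; exists (- v); rewrite -g -e /=; ring.
Qed.

Section GaussSum.
Variables (R : realType) (p alpha : nat).
Hypotheses (p_prime : prime p) (p_odd : odd p) (alpha_gt0 : (0 < alpha)%N).
Local Notation q := (p ^ (2 * alpha))%N.
Local Notation P := (p ^ alpha)%N.
Local Notation E := (expz R P).
Local Notation inv := (zinv q%:Z).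

Let p_gt0 : (0 < p)%N. Proof. exact: prime_gt0. Qed.
Let P_gt0 : (0 < P)%N. Proof. by rewrite expn_gt0 p_gt0. Qed.
Let q_gt0 : (0 < q)%N. Proof. by rewrite expn_gt0 p_gt0. Qed.
Let P_gt1 : (1 < P)%N.
Proof. by rewrite -{1}(expn0 p) ltn_exp2l ?prime_gt1. Qed.
Let qE : q = (P * P)%N. Proof. by rewrite -expnD addnn mul2n. Qed.
Let b_ge2 : (2 <= 2 * alpha)%N. Proof. lia. Qed.

(** For a unit x, x + P y = x (1 + P y / x) modulo q = P ^ 2; for a non-unit both sides vanish. *)
Lemma dchar_shift (chi : dirichlet_char R q) (x y : int) :
  chi (x + P%:Z * y) = chi x * E ((ell chi : nat)%:Z * inv x * y).
Proof.
have [cx|cx] := boolP (coprimez x q%:Z); last first.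
  rewrite !dchar_noncoprime ?mul0r//; apply: contra cx => /coprimezP[[u v] /= e].
  rewrite qE PoszM coprimezMr andbb.
  by apply/coprimezP; exists (u, u * y + v * P%:Z) => /=; rewrite -e qE PoszM; ring.
have /dvdzP[s hs] := zinvP _ _ cx.
have -> : E ((ell chi : nat)%:Z * inv x * y) = chi (1 + p%:Z ^+ alpha * (inv x * y)).
  rewrite (dchar_1Dppow _ _ _ p_prime p_odd b_ge2); [|lia|lia|lia].
  by rewrite (_ : (2 * alpha - alpha)%N = alpha) ?mulrA//; lia.
rewrite -dchar_mul; apply: dchar_eq; apply/dvdzP; exists (- s * P%:Z * y).
have e : x * inv x = 1 + s * q%:Z by rewrite -hs; ring.
rewrite -PoszX; transitivity (P%:Z * y * (1 - x * inv x)); first ring.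
by rewrite e; ring.
Qed.

Variables (chi psi : dirichlet_char R q).

Definition gterm (u t : int) : R[i] :=
  chi t * (chi (t + 1))^* * (chi u)^* * chi (u + 1) * psi (u * t - 1).

(** The logarithmic derivative of the summand in u; conjugated factors enter with a minus sign. *)
Definition phase_u (u t : int) : int :=
  (ell chi : nat)%:Z * (inv (u + 1) - inv u)
  + (ell psi : nat)%:Z * inv (u * t - 1) * t.

Definition phase_t (u t : int) : int :=
  (ell chi : nat)%:Z * (inv t - inv (t + 1))
  + (ell psi : nat)%:Z * inv (u * t - 1) * u.

Lemma gterm_shift (u t w z : int) :
  gterm (u + P%:Z * w) (t + P%:Z * z) =
  gterm u t * (E (phase_u u t * w) * E (phase_t u t * z)).
Proof.
rewrite /gterm.
have -> : (u + P%:Z * w) * (t + P%:Z * z) - 1 =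
    (u * t - 1) + P%:Z * (u * z + t * w + P%:Z * (w * z)) by ring.
rewrite ![_ + P%:Z * _ + 1]addrAC !dchar_shift !rmorphM /= !conj_expz.
set e1 := E _; set e2 := E _; set e3 := E _; set e4 := E _.
set c := (ell psi : nat)%:Z * _ * _.
(* The cross term P w z of the product is invisible modulo P. *)
rewrite (@expz_eq _ _ P_gt0 c ((ell psi : nat)%:Z * inv (u * t - 1) * (u * z + t * w))).
  rewrite -expzD.
  transitivity (gterm u t * (e1 * e2 * e3 * e4 *
     E ((ell psi : nat)%:Z * inv (u * t - 1) * (u * z + t * w)))).
    by rewrite /gterm; ring.
  congr (_ * _); rewrite /e1 /e2 /e3 /e4 -!expzD; congr E.
  by rewrite /phase_u /phase_t; ring.
rewrite /c -mulrBr; apply: dvdz_mull; apply/dvdzP; exists (w * z); ring.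
Qed.

Lemma gterm_periodic_t (u t : int) : gterm u (t + q%:Z) = gterm u t.
Proof.
rewrite /gterm addrAC !dchar_periodic; congr (_ * _); apply: dchar_eq.
by apply/dvdzP; exists u; ring.
Qed.

Lemma gterm_periodic_u (u t : int) : gterm (u + q%:Z) t = gterm u t.
Proof.
rewrite /gterm [u + _ + 1]addrAC !dchar_periodic; congr (_ * _); apply: dchar_eq.
by apply/dvdzP; exists t; ring.
Qed.

Lemma norm_gterm_le1 (u t : int) : `|gterm u t| <= 1.
Proof.
rewrite /gterm !normrM !norm_conjC.
by rewrite !mulr_ile1 ?mulr_ge0 ?normr_ge0 ?norm_dchar_le1.
Qed.

(** A nonzero summand makes all five character arguments units, as the inverses in the phases
    require. *)
Definition stationary : {set 'I_q * 'I_q} :=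
  [set x : 'I_q * 'I_q | [&& gterm x.1%:Z x.2%:Z != 0,
               (P%:Z %| phase_u x.1%:Z x.2%:Z)%Z &
               (P%:Z %| phase_t x.1%:Z x.2%:Z)%Z]].

(** By periodicity each of the P ^ 2 shifts of (u, t) leaves the sum unchanged; adding them all
    factors out two geometric sums. *)
Lemma gsum_average :
  (P * P)%:R * gsum chi psi =
  \sum_(x : 'I_q * 'I_q) gterm x.1%:Z x.2%:Z *
    ((\sum_(w < P) E (phase_u x.1%:Z x.2%:Z * w%:Z)) *
     (\sum_(z < P) E (phase_t x.1%:Z x.2%:Z * z%:Z))).
Proof.
transitivity (\sum_(w < P) \sum_(z < P) \sum_(u < q) \sum_(t < q)
    gterm (u%:Z + P%:Z * w%:Z) (t%:Z + P%:Z * z%:Z)).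
  transitivity (\sum_(w < P) \sum_(z < P) gsum chi psi).
    by rewrite !sumr_const !card_ord mulr_natl mulrnA.
  apply: eq_bigr => w _; apply: eq_bigr => z _; apply/esym.
  rewrite -PoszM (sum_periodic_shift _ _
    (fun x => \sum_(t < q) gterm x (t%:Z + (P%:Z * z%:Z)))); last first.
    by move=> x; apply: eq_bigr => t _; rewrite gterm_periodic_u.
  apply: eq_bigr => u _; rewrite -PoszM sum_periodic_shift// => x.
  exact: gterm_periodic_t.
rewrite -(pair_bigA _ (fun u t : 'I_q => gterm u%:Z t%:Z *
    ((\sum_(w < P) E (phase_u u%:Z t%:Z * w%:Z)) *
     (\sum_(z < P) E (phase_t u%:Z t%:Z * z%:Z))))) /=.
transitivity (\sum_(w < P) \sum_(u < q) \sum_(t < q) \sum_(z < P)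
    gterm (u%:Z + P%:Z * w%:Z) (t%:Z + P%:Z * z%:Z)).
  apply: eq_bigr => w _; rewrite exchange_big; apply: eq_bigr => u _.
  by rewrite exchange_big.
rewrite exchange_big; apply: eq_bigr => u _.
rewrite exchange_big; apply: eq_bigr => t _.
rewrite big_distrlr mulr_sumr; apply: eq_bigr => w _ /=.
by rewrite mulr_sumr; apply: eq_bigr => z _; rewrite gterm_shift.
Qed.

(** By orthogonality each inner sum is P or 0, so each stationary pair contributes at most P ^ 2,
    which cancels the factor of the average. *)
Lemma norm_gsum_le : `|gsum chi psi| <= #|stationary|%:R.
Proof.
have PP : 0 < (P * P)%:R :> R[i] by rewrite ltr0n muln_gt0 P_gt0.
rewrite -(ler_pM2l PP) -{1}[(P * P)%:R]ger0_norm ?ler0n// -normrM gsum_average.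
apply: le_trans (ler_norm_sum _ _ _) _.
rewrite mulr_natr -sumr_const [leRHS]big_mkcond /=.
apply: ler_sum => x _; rewrite !sum_expz// inE.
have [->|_] /= := eqVneq (gterm _ _) 0; first by rewrite mul0r normr0.
do 2! (case: ifP => _ /=; last by rewrite ?mulr0 ?mul0r ?mulr0 normr0).
by rewrite -natrM normrM normr_nat ler_piMl// norm_gterm_le1.
Qed.

(** A stationary pair is encoded by the residue of 2 (t + 1) + A modulo P, a square root of Delta,
    and the quotients of u and t by P. There are P ^ 2 = q pairs of quotients. *)
Lemma card_stationary (A : int) : coprime p (ell psi) ->
  (P%:Z %| A * (ell psi : nat)%:Z - (ell chi : nat)%:Z)%Z ->
  (#|stationary| <= q * rho (A ^+ 2 + 4) P)%N.
Proof.
move=> cb aAb; set Delta := A ^+ 2 + 4.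
have inv1 (x : int) : coprimez x q%:Z -> x%:~R * (inv x)%:~R = 1 :> 'Z_P.
  move=> /zinvP h; rewrite -intrM; apply: (Zp_int_eq _ _ 1) => //.
  by apply: dvdz_trans h; rewrite qE PoszM dvdz_mulr.
have sol (u t : int) : gterm u t != 0 -> (P%:Z %| phase_u u t)%Z ->
    (P%:Z %| phase_t u t)%Z ->
    (P%:Z %| u - (- t - 2))%Z /\ (P%:Z %| (2 * (t + 1) + A) ^+ 2 - Delta)%Z.
  rewrite /gterm !mulf_eq0 !negb_or !fmorph_eq0.
  move=> /andP[/andP[/andP[/andP[ct ct1] cu] cu1] cv].
  rewrite -!Zp_int_eq0// /phase_u /phase_t => /eqP eu /eqP et.
  have [b' hb'] : exists b', (P%:Z %| (ell psi : nat)%:Z * b' - 1)%Z.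
    by apply: coprimez_inv; rewrite coprimezE /= coprime_sym coprimeXl.
  have [||||||||| h1 h2] := @stationary_point 'Z_P
    (ell chi : nat)%:Z%:~R (ell psi : nat)%:Z%:~R b'%:~R A%:~R t%:~R (inv t)%:~R (inv (t + 1))%:~R u%:~R (inv u)%:~R
    (inv (u + 1))%:~R (inv (u * t - 1))%:~R .
  - by rewrite -intrM; apply: Zp_int_eq => //; rewrite -rpredN opprB.
  - by rewrite -intrM; apply: (Zp_int_eq _ _ 1).
  - exact/inv1/(dchar_coprime _ _ _ _ ct).
  - by have := inv1 _ (dchar_coprime _ _ _ _ ct1); rewrite intrD.
  - exact/inv1/(dchar_coprime _ _ _ _ cu).
  - by have := inv1 _ (dchar_coprime _ _ _ _ cu1); rewrite intrD.
  - by have := inv1 _ (dchar_coprime _ _ _ _ cv); rewrite intrB intrM.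
  - by rewrite -et intrD !intrM intrB.
  - by rewrite -eu intrD !intrM intrB.
  split; rewrite intrB subr_eq0.
    by rewrite intrB mulrNz h1.
  rewrite rmorphXn /= /Delta intrD [in eqbRHS]intrD rmorphXn /= -h2.
  by rewrite intrM intrD.
pose modP (k : nat) : 'I_P := Ordinal (ltn_pmod k P_gt0).
pose root_of (x : 'I_q * 'I_q) : int := ((2 * (x.2%:Z + 1) + A) %% P%:Z)%Z.
have root_ge0 x : 0 <= root_of x by rewrite modz_ge0// eqz_nat -lt0n.
have root_dvd x : (P%:Z %| (`|root_of x| %% P)%N%:Z - (2 * (x.2%:Z + 1) + A))%Z.
  rewrite -eqz_mod_dvd -modz_nat modz_mod abszE (ger0_norm (root_ge0 x)).
  by rewrite modz_mod.
pose f (x : 'I_q * 'I_q) : 'I_P * ('I_P * 'I_P) :=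
  (modP `|root_of x|%N, (modP (x.1 %/ P)%N, modP (x.2 %/ P)%N)).
have divP (k : 'I_q) : (k %/ P < P)%N by rewrite ltn_divLR// -qE.
have modE (k l : nat) : (P%:Z %| k%:Z - l%:Z)%Z -> (k %/ P = l %/ P)%N -> k = l.
  rewrite -eqz_mod_dvd !modz_nat eqz_nat => /eqP e1 e2.
  by rewrite (divn_eq k P) e1 e2 -divn_eq.
have f_inj : {in stationary &, injective f}.
  move=> [u t] [u' t']; rewrite !inE /= => /and3P[g1 g2 g3] /and3P[g1' g2' g3'].
  have [s1 _] := sol _ _ g1 g2 g3; have [s1' _] := sol _ _ g1' g2' g3'.
  move=> [er]; rewrite !modn_small// => eu et.
  (* As p is odd, 2 is invertible modulo P, so the root determines t modulo P, and then u = - t -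
     2. *)
  have tt' : (P%:Z %| t%:Z - t'%:Z)%Z.
    have c2 : coprimez P%:Z 2%:Z.
      by rewrite coprimezE /= coprimeXl// coprimen2.
    have := root_dvd (u, t); have := root_dvd (u', t'); rewrite er /=.
    move=> /dvdzP[a ha] /dvdzP[b hb]; rewrite -(Gauss_dvdzr _ c2).
    apply/dvdzP; exists (a - b); rewrite mulrBl -ha -hb; ring.
  have tE : t = t' by apply/val_inj/modE.
  congr (_, _) => //; apply/val_inj/modE => //.
  move: s1 s1' => /dvdzP[a ha] /dvdzP[b hb]; rewrite tE in ha.
  apply/dvdzP; exists (a - b); rewrite mulrBl -ha -hb; ring.
rewrite -(card_in_imset f_inj) [X in (_ <= X)%N]mulnC [X in (_ <= _ * X)%N]qE /rho.
set S := [set x | _] : {set 'I_P}.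
have : [set f x | x in stationary] \subset finset.setX S [set: 'I_P * 'I_P]%SET.
  apply/fintype.subsetP => _ /imsetP[[u t] st ->]; move: st.
  rewrite !inE /= => /and3P[g1 g2 g3].
  have [_ s2] := sol _ _ g1 g2 g3; rewrite andbT eqz_mod_dvd.
  have /dvdzP[a ha] := root_dvd (u, t); move: s2 => /dvdzP[b hb].
  set k := (_ %% _)%N in ha *.
  have -> : k%:Z = 2 * (t%:Z + 1) + A + a * P%:Z by rewrite -ha /=; ring.
  apply/dvdzP; exists (b + a * (2 * (2 * (t%:Z + 1) + A) + a * P%:Z)).
  by rewrite [RHS]mulrDl -hb; ring.
by move/subset_leq_card; rewrite cardsX cardsT card_prod !card_ord.
Qed.

End GaussSum.

Theorem theorem3p3 (R : realType) (p alpha beta : nat)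
    (p_prime : prime p) (p_odd : odd p)
    (alpha_ge1 : (1 <= alpha)%N) (beta_def : beta = (2 * alpha)%N)
    (chi psi : dirichlet_char R (p ^ beta))
    (chi_primitive : primitive_char chi) (psi_primitive : primitive_char psi)
    (A Delta : int)
    (A_def : A%:~R = ell chi / ell psi :> 'Z_(p ^ beta.-1))
    (Delta_def : Delta = A ^+ 2 + 4) :
  `| gsum chi psi | <= (p ^ beta)%N%:R * (rho Delta (p ^ alpha))%:R.
Proof.
have b_ge2 : (2 <= beta)%N by lia.
subst beta; set b := (2 * alpha)%N in chi psi chi_primitive psi_primitive b_ge2 A_def *.
have cpsi := coprime_ell _ _ _ p_prime p_odd b_ge2 psi psi_primitive.
have q1 : (1 < p ^ b.-1)%N.
  by rewrite -{1}(expn0 p) ltn_exp2l ?prime_gt1//; lia.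
(* The congruence descends from p ^ (2 alpha - 1) to p ^ alpha as alpha >= 1; the quotient is a true
   one because ell_psi is a unit. *)
have AE : ((p ^ alpha)%N%:Z %| A * (ell psi : nat)%:Z - (ell chi : nat)%:Z)%Z.
  apply: (@dvdz_trans (p ^ b.-1)%N%:Z); first by rewrite dvdzE /= dvdn_exp2l//; lia.
  rewrite -Zp_int_eq0// intrB intrM A_def -!pmulrn !natr_Zp divrK ?subrr//.
  by rewrite -[ell psi]natr_Zp unitZpE// coprimeXl.
apply: le_trans (norm_gsum_le _ _ _ p_prime p_odd alpha_ge1 chi psi) _.
by rewrite -natrM ler_nat Delta_def card_stationary.
Qed.
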